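(* Let $x_1=0$, $x_2=1$, and for $n\ge 2$ let $x_{n+1}=x_{\chi_n}+\varepsilon_{n+1}\,d_n(x_{\chi_n})\,\eta_{n+1}$, where $d_n(x_k)=\min\{|x_k-x_j|:1\le j\le n,\ j\ne k\}$ and where $\{\chi_n\}$, $\{\varepsilon_n\}$, $\{\eta_n\}$ are mutually independent sequences of independent random variables with $\chi_n$ uniform on $\{1,\dots,n\}$, $\varepsilon_n=\pm1$ with probability $1/2$ each, and $\eta_n$ uniform on $[0,1]$. Put $X_n=\{x_1,\dots,x_n\}$, $m_n=\min\{x: x\in X_n\}$ and $M_n=\max\{x: x\in X_n\}$. Then $$\mathbf{P}\{-\infty<\liminf_{n\to\infty} m_n\le \limsup_{n\to\infty} M_n<+\infty\}=1.$$
   Context: The process is the one-dimensional locally interacting sequential adsorption (LISA) process: at each step a parent particle is chosen uniformly among the $n$ existing particles, and a new particle is added uniformly at random in the interval centred at the parent whose half-length is the distance from the parent to its nearest other particle. *)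

(* Defs.v *)
From HB Require Import structures.
From mathcomp Require Import all_boot all_order all_algebra finmap.
From mathcomp Require Import all_classical all_reals all_analysis.
Set Implicit Arguments.
Unset Strict Implicit.
Unset Printing Implicit Defensive.
Import Order.TTheory GRing.Theory Num.Theory.
Import numFieldNormedType.Exports.

Local Open Scope classical_set_scope.
Local Open Scope ring_scope.

Section independence.
Context {d : measure_display} {T : measurableType d} {R : realType}.
Variable P : probability T R.

Definition independent (I : choiceType) (D : set I) (F : I -> set_system T) :=
  forall (J : {fset I}) (E : I -> set T), [set` J] `<=` D ->
    (forall i, i \in J -> F i (E i)) ->
    P (\bigcap_(i in [set` J]) E i) = (\prod_(i <- J) P (E i))%E.

Definition sigma_rv {d'} {T' : measurableType d'} (X : {RV P >-> T'}) :
    set_system T :=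
  preimage_set_system setT X measurable.

Definition sigma_seq {d'} {T' : measurableType d'} (D : set nat)
    (X : nat -> {RV P >-> T'}) : set_system T :=
  <<s \bigcup_(n in D) sigma_rv (X n) >>.

(* The three sequences may take values in different spaces, so their mutual
   independence is that of the sigma-algebras they generate. *)
Definition independent_sequences3 {d1 d2 d3} {T1 : measurableType d1}
    {T2 : measurableType d2} {T3 : measurableType d3} (D1 D2 D3 : set nat)
    (X1 : nat -> {RV P >-> T1}) (X2 : nat -> {RV P >-> T2})
    (X3 : nat -> {RV P >-> T3}) :=
  independent [set: 'I_3] (fun i : 'I_3 => nth set0
    [:: sigma_seq D1 X1; sigma_seq D2 X2; sigma_seq D3 X3] i).

End independence.

Section process.
Context {R : realType}.
Implicit Types (x : nat -> R) (n k : nat).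

(* Particles are numbered from 1; [x 0] is never used.  The value +oo is the
   minimum over the empty set, which does not occur when 2 <= n. *)
Definition nearest_dist x n k : R :=
  fine (\big[mine/+oo%E]_(1 <= j < n.+1 | j != k) (`|x k - x j|)%:E).

Definition particles x n : seq R := [seq x i | i <- iota 1 n].

(* Since x 1 belongs to [particles x n] when 1 <= n, using it as the initial
   value of the iterated min and max does not change their values. *)
Definition leftmost x n : R := \big[Num.min/x 1%N]_(y <- particles x n) y.
Definition rightmost x n : R := \big[Num.max/x 1%N]_(y <- particles x n) y.

(* [lisa_config chi eps eta s] gives the positions of the particles
   1, ..., s + 2 present after s steps (and 0 at any other index). *)
Fixpoint lisa_config (chi : nat -> nat) (eps eta : nat -> R) (s : nat) :
    nat -> R :=
  if s is s'.+1 then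
    let n := s'.+2 in
    let x := lisa_config chi eps eta s' in
    fun k => if k == n.+1
             then x (chi n) + eps n.+1 * nearest_dist x n (chi n) * eta n.+1
             else x k
  else fun k => (k == 2)%:R.

Definition lisa chi eps eta k : R := lisa_config chi eps eta k k.

Lemma lisa1 chi eps eta : lisa chi eps eta 1 = 0.
Proof. by []. Qed.

Lemma lisa2 chi eps eta : lisa chi eps eta 2 = 1.
Proof. by []. Qed.

Lemma lisa_config_stable chi eps eta s k : (1 <= k <= s.+2)%N ->
  lisa_config chi eps eta s k = lisa chi eps eta k.
Proof.
move=> /andP[k1 ks].
have step t : (k <= t.+2)%N ->
    lisa_config chi eps eta t.+1 k = lisa_config chi eps eta t k.
  by move=> kt /=; rewrite ltn_eqF.
have H t : (k <= t.+2)%N ->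
    lisa_config chi eps eta t k = lisa_config chi eps eta k.-2 k.
  elim: t => [|t IH] kt; first by case: k k1 kt {ks step} => [|[|[|]]].
  have [kt'|kt'] := leqP k t.+2; first by rewrite step // IH.
  by have -> : k = t.+3 by apply/eqP; rewrite eqn_leq kt kt'.
by rewrite /lisa (H s) // (H k) // ltnW.
Qed.

Lemma lisaS chi eps eta n (x := lisa chi eps eta) :
  (2 <= n)%N -> (1 <= chi n <= n)%N ->
  x n.+1 = x (chi n) + eps n.+1 * nearest_dist x n (chi n) * eta n.+1.
Proof.
case: n => [|[|s]] // _ cn; rewrite /x -(@lisa_config_stable _ _ _ s.+1) //=.
rewrite eqxx lisa_config_stable//; congr (_ + _ * _ * _); congr fine.
rewrite [LHS]big_nat_cond [RHS]big_nat_cond; apply: eq_bigr => j /andP[jn _].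
by rewrite !lisa_config_stable.
Qed.

End process.

(* Main.v *)
Require Import Defs.
From HB Require Import structures.
From mathcomp Require Import all_boot all_order all_algebra finmap.
From mathcomp Require Import all_classical all_reals all_analysis.
From mathcomp Require Import measurable_realfun.
From mathcomp Require Import lra zify.
Set Implicit Arguments.
Unset Strict Implicit.
Unset Printing Implicit Defensive.
Import Order.TTheory GRing.Theory Num.Theory.
Import numFieldNormedType.Exports.

Local Open Scope classical_set_scope.
Local Open Scope ring_scope.

(** Why the process stays bounded.

Let r be the rightmost particle at time n and g its distance to the nearest
other particle.  A parent other than r sends its child no further than r,
because its own distance to the nearest particle is at most its distance to r.
So the maximum moves only when r itself is the parent, and then by at most g.
Such a step also shrinks the gap: the child sits at distance eta * g from the
old maximum, whichever side it falls on, and one of the two is the new maximum.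
All other steps leave the gap no larger ([max_step], [gap_step]).

The parent is r with probability 1/n, independently of the past, and then
eta <= 1/2 with probability 1/2, which costs the gap at least one half of its
value.  Hence the mean gap e_n satisfies

  e_(n+1) + e_n / (4 n) <= e_n                             ([mean_gap_step])

and telescoping gives sum_n e_n / n <= 4 e_2 <= 4.  But e_n / n is the mean of
an upper bound for the displacement of the maximum at step n, so the total
displacement has mean at most 4 ([mean_total_lty]) and is almost surely finite.

The same argument applied to the reflected positions - x_k bounds the minimum.
Both ends are treated together by working with s * x_k where |s| = 1
([ae_bounded_above]).

The probabilistic input is the identity: the integral of h over F is P F times
the integral of h, for h >= 0 measurable with respect to the past and F an
event about chi_n and eta_(n+1).  It is obtained from the product rule on the
pi-system of cylinder events ([history], [history_indep]) by uniqueness of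
measures ([integral_indep]).  The position of the parent of the next particle
depends on a random index, so measurability of the process is an induction in
which each random index is split over its countably many values
([measurable_fun_natsel], [measurable_lisa]). *)

(** * Nearest distances *)

Section nearest_dist.
Context {R : realType}.
Implicit Types (y : nat -> R) (n k j : nat).

Lemma big_mine_attained (I : eqType) (s : seq I) (Q : pred I) (f : I -> R) :
  has Q s -> exists j : I, [/\ j \in s, Q j,
    (\big[mine/+oo]_(i <- s | Q i) (f i)%:E = (f j)%:E)%E &
    forall i : I, i \in s -> Q i -> f j <= f i].
Proof.
elim: s => // a s IH /=; rewrite big_cons.
have [hs _|hs] := boolP (has Q s); last first.
  rewrite orbF => Qa; exists a; rewrite Qa mem_head; split=> //.
    by rewrite big_hasC// miney.
  move=> i /[!inE]/orP[/eqP->//|si Qi].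
  by move/hasPn: hs => /(_ _ si); rewrite Qi.
have [j [sj Qj -> jmin]] := IH hs; case: ifPn => Qa; last first.
  exists j; rewrite inE sj orbT; split=> // i /[!inE] /orP[/eqP->|].
    by rewrite (negPf Qa).
  exact: jmin.
rewrite -EFin_min; have [aj|ja] := leP (f a) (f j).
  exists a; rewrite mem_head; split=> // i /[!inE] /orP[/eqP->//|si Qi].
  by rewrite (le_trans aj)// jmin.
exists j; rewrite inE sj orbT; split=> // i /[!inE] /orP[/eqP->|].
  by rewrite ltW.
exact: jmin.
Qed.

(** As soon as there are two particles the minimum in [nearest_dist] is over a
nonempty set, hence attained; the conventions about infinity then disappear. *)
Lemma nearest_distP y n k : (2 <= n)%N ->
  (exists j,
    [/\ (1 <= j <= n)%N, j != k & nearest_dist y n k = `|y k - y j|]) /\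
  (forall j, (1 <= j <= n)%N -> j != k -> nearest_dist y n k <= `|y k - y j|).
Proof.
move=> n2.
have : has (fun j => j != k) (index_iota 1 n.+1).
  (* Particle 1 or particle 2 differs from k. *)
  apply/hasP; exists (if k == 1%N then 2%N else 1%N).
    by rewrite mem_index_iota; case: ifP => _; lia.
  by case: (eqVneq k 1%N) => [->|]; rewrite 1?eq_sym.
move=> /(big_mine_attained (fun j => `|y k - y j|))[j [jn jk jE jmin]].
split.
  exists j; split=> //; first by rewrite mem_index_iota ltnS in jn.
  by rewrite /nearest_dist jE.
move=> i i_n ik; rewrite /nearest_dist jE /=; apply: jmin => //.
by rewrite mem_index_iota ltnS.
Qed.

Lemma nearest_dist_ge0 y n k : (2 <= n)%N -> 0 <= nearest_dist y n k.
Proof. by move=> /(nearest_distP y)-/(_ k)[[j [_ _ ->]]]. Qed.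

Lemma nearest_dist_le y n k j : (2 <= n)%N -> (1 <= j <= n)%N -> j != k ->
  nearest_dist y n k <= `|y k - y j|.
Proof. by move=> n2; apply: (nearest_distP y _ n2).2. Qed.

Lemma nearest_distS_le y n k : (2 <= n)%N ->
  nearest_dist y n.+1 k <= nearest_dist y n k.
Proof.
move=> n2; have [[j [/andP[j1 jn] jk ->]] _] := nearest_distP y k n2.
by apply: nearest_dist_le jk; rewrite ?j1 ltnW.
Qed.

(** Distances do not see a reflection, which is why the left end of the
configuration needs no separate treatment. *)
Lemma nearest_distM s y n k : `|s| = 1 ->
  nearest_dist (fun i => s * y i) n k = nearest_dist y n k.
Proof.
move=> s1; congr fine; apply: eq_bigr => j _.
by rewrite -mulrBr normrM s1 mul1r.
Qed.

End nearest_dist.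

(** * The rightmost particle and its gap *)

Section rightmost_particle.
Context {R : realType}.
Implicit Types (y : nat -> R) (n k : nat).

(** Ties are broken in favour of the oldest particle, so that the index changes
only when the maximum strictly increases.  The value 1 at time 0 makes the
recursion start at particle 1. *)
Fixpoint argmax y n : nat :=
  if n is n'.+1 then if y (argmax y n') < y n then n else argmax y n' else 1%N.

Lemma argmaxS y n :
  argmax y n.+1 = if y (argmax y n) < y n.+1 then n.+1 else argmax y n.
Proof. by []. Qed.

Lemma argmax_bounds y n : (1 <= n)%N -> (1 <= argmax y n <= n)%N.
Proof.
elim: n => // -[|n] IH _ /=; first by rewrite ltxx.
case: ifP => _; first by rewrite leqnn.
by have /andP[-> /leqW] := IH isT.
Qed.

Lemma le_argmax y n k : (1 <= k <= n)%N -> y k <= y (argmax y n).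
Proof.
elim: n => [|n IH] /andP[k1]; first by rewrite leqNgt k1.
rewrite leq_eqVlt ltnS => /orP[/eqP->/=|kn].
  by case: ltP.
have {}IH := IH _; rewrite k1 kn in IH; move/(_ isT) : IH => IH /=.
by case: ltP => // /ltW; apply: le_trans.
Qed.

Lemma rightmost_le y n c :
  (forall k, (1 <= k)%N -> y k <= c) -> rightmost y n <= c.
Proof.
move=> yc; rewrite /rightmost /particles big_map big_seq_cond.
elim/big_ind: _ => [|a b|k]; first by rewrite yc.
  by rewrite ge_max => -> ->.
by rewrite mem_iota => /andP[/andP[k1 _] _]; exact: yc.
Qed.

Lemma leftmost_ge y n c :
  (forall k, (1 <= k)%N -> c <= y k) -> c <= leftmost y n.
Proof.
move=> yc; rewrite /leftmost /particles big_map big_seq_cond.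
elim/big_ind: _ => [|a b|k]; first by rewrite yc.
  by rewrite le_min => -> ->.
by rewrite mem_iota => /andP[/andP[k1 _] _]; exact: yc.
Qed.

Lemma leftmost_le_rightmost y n : leftmost y n <= rightmost y n.
Proof.
rewrite /leftmost /rightmost; case: n => [|n].
  by rewrite /particles /= !big_nil.
rewrite /particles /= !big_cons; apply: (@le_trans _ _ (y 1%N)).
  by rewrite ge_min lexx.
by rewrite le_max lexx.
Qed.

Definition gap y n := nearest_dist y n (argmax y n).

Lemma gap_ge0 y n : (2 <= n)%N -> 0 <= gap y n.
Proof. exact: nearest_dist_ge0. Qed.

(** All that the argument retains of one step: an admissible parent and an upper
bound for the displacement.  This form is invariant under reflection. *)
Definition lisa_step y (c : nat -> nat) (e : nat -> R) n :=
  [/\ (1 <= c n <= n)%N, 0 <= e n.+1 <= 1 &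
      `|y n.+1 - y (c n)| <= nearest_dist y n (c n) * e n.+1].

(** A parent k other than the rightmost particle r has nearest distance at most
y_r - y_k, so that its child does not pass y_r. *)
Lemma new_max_parent y c e n : (2 <= n)%N -> lisa_step y c e n ->
  y (argmax y n) < y n.+1 -> c n = argmax y n.
Proof.
move=> n2 [cn /andP[e0 e1] ystep] ymax; apply/eqP; apply: contraT => cr.
have cmax := le_argmax y cn.
have d0 := nearest_dist_ge0 y (c n) n2.
have d_le : nearest_dist y n (c n) <= y (argmax y n) - y (c n).
  rewrite -[leRHS]ger0_norm ?subr_ge0// distrC.
  by apply: nearest_dist_le; rewrite // ?argmax_bounds 1?ltnW// eq_sym.
move: ystep; rewrite ler_norml => /andP[_ ystep]; nra.
Qed.

Lemma max_step y c e n : (2 <= n)%N -> lisa_step y c e n ->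
  y (argmax y n.+1) <= y (argmax y n) + gap y n * (c n == argmax y n)%:R.
Proof.
move=> n2 st; have g0 := gap_ge0 y n2; rewrite argmaxS; case: ltP => ymax.
  rewrite -(new_max_parent n2 st ymax) eqxx mulr1.
  case: (st) => _ /andP[e0 e1]; rewrite /gap (new_max_parent n2 st ymax).
  rewrite ler_norml => /andP[_]; rewrite -/(gap y n) => ?; nra.
by rewrite lerDl mulr_ge0.
Qed.

(** If the rightmost particle r is the parent, then r and its child are at
distance at most eta times the old gap, and the new rightmost particle is one of
the two.  Otherwise r stays rightmost and its gap cannot grow. *)
Lemma gap_step y c e n : (2 <= n)%N -> lisa_step y c e n ->
  gap y n.+1 +
    2^-1 * (gap y n * ((c n == argmax y n) && (0 <= e n.+1 <= 2^-1))%:R)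
    <= gap y n.
Proof.
move=> n2 st; have g0 := gap_ge0 y n2; have n3 := leqW n2.
have /andP[r1 rn] := argmax_bounds y (ltnW n2).
have near_new : c n = argmax y n -> gap y n.+1 <= gap y n * e n.+1.
  move=> cr; case: (st) => _ _; rewrite cr; apply: le_trans.
  rewrite /gap argmaxS; case: ltP => _.
    by apply: nearest_dist_le; rewrite // ?r1 ?leqW// neq_ltn ltnS rn.
  rewrite distrC; apply: nearest_dist_le; rewrite // ?ltnSn//.
  by rewrite neq_ltn ltnS rn orbT.
have [cr|cr] := eqVneq (c n) (argmax y n) => /=.
  have := near_new cr; case: (st) => _ /andP[e0 e1] _.
  rewrite e0; case: (leP (e n.+1) 2^-1) => e2 near_e;
    rewrite ?mulr1 ?mulr0; nra.
rewrite !mulr0 addr0 /gap argmaxS; case: ltP => [ymax|_].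
  by rewrite (new_max_parent n2 st ymax) eqxx in cr.
exact: nearest_distS_le.
Qed.

Lemma max_le_sum y c e : (forall n, (2 <= n)%N -> lisa_step y c e n) ->
  forall n, y (argmax y n.+2) <=
    y (argmax y 2) + \sum_(i < n) gap y i.+2 * (c i.+2 == argmax y i.+2)%:R.
Proof.
move=> st; elim=> [|n IH]; first by rewrite big_ord0 addr0.
rewrite big_ord_recr /= addrA; apply: le_trans (max_step _ (st n.+2 _)) _ => //.
by rewrite lerD2r.
Qed.

End rightmost_particle.

(** * Measurability of the process *)

Section measurability.
Context {d : measure_display} {T : measurableType d} {R : realType}.

(** Selecting a function by a random index with values in a countable set D
preserves measurability.  Restricting to D matters for the past sigma-algebra,
with respect to which the later particles are not measurable. *)
Lemma measurable_fun_natsel {d'} {U : measurableType d'} (k : T -> nat)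
    (D : set nat) (f : nat -> T -> U) :
  measurable_fun setT k -> (forall w, D (k w)) ->
  (forall n, D n -> measurable_fun setT (f n)) ->
  measurable_fun setT (fun w => f (k w) w).
Proof.
move=> mk Dk mf _ B mB; rewrite setTI.
rewrite (_ : _ @^-1` B = \bigcup_(n in D) (k @^-1` [set n] `&` f n @^-1` B)).
  apply: bigcup_measurable => n Dn; apply: measurableI.
    by rewrite -[_ @^-1` _]setTI; exact: mk.
  by rewrite -[_ @^-1` _]setTI; exact: mf.
apply/seteqP; split=> [w Bw|w [n _ [/= kn Bn]]]; last by rewrite /= kn.
by exists (k w).
Qed.

Lemma measurable_bigminr (I : eqType) (s : seq I) (f : I -> T -> R)
    (g : T -> R) :
  (forall i, i \in s -> measurable_fun setT (f i)) -> measurable_fun setT g ->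
  measurable_fun setT (fun w => \big[Num.min/g w]_(i <- s) f i w).
Proof.
move=> + mg; elim: s => [|i s IH] mf; first by under eq_fun do rewrite big_nil.
under eq_fun do rewrite big_cons; apply: measurable_minr.
  by apply: mf; rewrite mem_head.
by apply: IH => j sj; apply: mf; rewrite inE sj orbT.
Qed.

Lemma measurable_bigmaxr (I : eqType) (s : seq I) (f : I -> T -> R)
    (g : T -> R) :
  (forall i, i \in s -> measurable_fun setT (f i)) -> measurable_fun setT g ->
  measurable_fun setT (fun w => \big[Num.max/g w]_(i <- s) f i w).
Proof.
move=> + mg; elim: s => [|i s IH] mf; first by under eq_fun do rewrite big_nil.
under eq_fun do rewrite big_cons; apply: measurable_maxr.
  by apply: mf; rewrite mem_head.
by apply: IH => j sj; apply: mf; rewrite inE sj orbT.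
Qed.

Lemma measurable_big_mine (I : eqType) (s : seq I) (Q : pred I)
    (f : I -> T -> \bar R) :
  (forall i, i \in s -> measurable_fun setT (f i)) ->
  measurable_fun setT (fun w => \big[mine/+oo%E]_(i <- s | Q i) f i w).
Proof.
elim: s => [|i s IH] mf.
  by under eq_fun do rewrite big_nil; exact: measurable_cst.
have {}IH :
    measurable_fun setT (fun w => \big[mine/+oo%E]_(j <- s | Q j) f j w).
  by apply: IH => j sj; apply: mf; rewrite inE sj orbT.
under eq_fun do rewrite big_cons; case: (Q i) => //.
by apply: measurable_mine => //; apply: mf; rewrite mem_head.
Qed.

Lemma measurable_natr_bool (b : T -> bool) : measurable_fun setT b ->
  measurable_fun setT (fun w => (b w)%:R : R).
Proof.
move=> mb; rewrite (_ : (fun w => _) = fun w => if b w then 1 else 0).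
  by apply: measurable_fun_ifT => //; exact: measurable_cst.
by apply/funext => w; case: (b w).
Qed.

Lemma measurable_nearest_dist (y : T -> nat -> R) n k :
  (forall j, (1 <= j <= n)%N -> measurable_fun setT (y^~ j)) ->
  measurable_fun setT (y^~ k) ->
  measurable_fun setT (fun w => nearest_dist (y w) n k).
Proof.
move=> my myk.
apply: (measurableT_comp
  (fine_measurable (measurableT : measurable [set: \bar R]))).
apply: measurable_big_mine => j; rewrite mem_index_iota ltnS => jn.
apply/measurable_EFinP; apply: measurableT_comp => //.
by apply: measurable_funB => //; exact: my.
Qed.

Lemma measurable_argmax (y : T -> nat -> R) n : (1 <= n)%N ->
  (forall j, (1 <= j <= n)%N -> measurable_fun setT (y^~ j)) ->
  measurable_fun setT (fun w => argmax (y w) n).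
Proof.
elim: n => // -[|n] IH _ my.
  by under eq_fun do rewrite /= ltxx; exact: measurable_cst.
have {}IH : measurable_fun setT (fun w => argmax (y w) n.+1).
  by apply: IH => // j /andP[j1 jn]; apply: my; rewrite j1 leqW.
under eq_fun do rewrite argmaxS; apply: measurable_fun_ifT => //.
apply: measurable_fun_ltr; last by apply: my; rewrite leqnn.
apply: (@measurable_fun_natsel _ _ (fun w => argmax (y w) n.+1)
  [set k | (1 <= k <= n.+1)%N] (fun k w => y w k)) => // [w|k /= /andP[k1 kn]].
  exact: argmax_bounds.
by apply: my; rewrite k1 leqW.
Qed.

Lemma measurable_gap (y : T -> nat -> R) n : (1 <= n)%N ->
  (forall j, (1 <= j <= n)%N -> measurable_fun setT (y^~ j)) ->
  measurable_fun setT (fun w => gap (y w) n).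
Proof.
move=> n1 my; apply: (@measurable_fun_natsel _ _ (fun w => argmax (y w) n)
  [set k | (1 <= k <= n)%N] (fun k w => nearest_dist (y w) n k)).
- exact: measurable_argmax.
- by move=> w; exact: argmax_bounds.
- by move=> k kn; apply: measurable_nearest_dist => //; exact: my.
Qed.

(** The first n particles are determined by chi_i for i < n and by eps_i, eta_i
for i <= n only; [T] may therefore carry the sigma-algebra of the past. *)
Lemma measurable_lisa (c : T -> nat -> nat) (e h : T -> nat -> R) n :
  (forall i, (2 <= i < n)%N -> measurable_fun setT (c^~ i)) ->
  (forall i, (3 <= i <= n)%N -> measurable_fun setT (e^~ i)) ->
  (forall i, (3 <= i <= n)%N -> measurable_fun setT (h^~ i)) ->
  forall k, (1 <= k <= n)%N ->
  measurable_fun setT (fun w => lisa (c w) (e w) (h w) k).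
Proof.
move=> mc me mh k kn.
(* [maxn n 2] because [n.-2.+2], the number of particles of the configuration
   used at the end, is 2 when n < 2. *)
have mconfig s : (s.+2 <= maxn n 2)%N -> forall j,
    measurable_fun setT (fun w => lisa_config (c w) (e w) (h w) s j).
  elim: s => [|s IH] sn j; first exact: measurable_cst.
  have {}IH := IH (ltnW sn).
  have sn' : (s.+2 < n)%N by lia.
  rewrite /=; case: (j == s.+3); last exact: IH.
  have mcs : measurable_fun setT (fun w => c w s.+2) by apply: mc; lia.
  have mmul (f g : T -> R) : measurable_fun setT f -> measurable_fun setT g ->
    measurable_fun setT (fun w => f w * g w) by exact: measurable_funM.
  apply: measurable_funD.
    exact: (@measurable_fun_natsel _ _ (fun w => c w s.+2) setT
      (fun k w => lisa_config (c w) (e w) (h w) s k)).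
  apply: (mmul); last by apply: mh; lia.
  apply: (mmul); first by apply: me; lia.
  apply: (@measurable_fun_natsel _ _ (fun w => c w s.+2) setT
    (fun k w => nearest_dist (lisa_config (c w) (e w) (h w) s) s.+2 k)) =>
    // i _.
  by apply: (measurable_nearest_dist
    (y := fun w => lisa_config (c w) (e w) (h w) s)).
rewrite (_ : (fun w => _) = fun w => lisa_config (c w) (e w) (h w) n.-2 k).
  by apply: mconfig; lia.
by apply/funext => w; rewrite lisa_config_stable //; lia.
Qed.

Lemma measurable_leftmost (x : T -> nat -> R) n :
  (forall k, (1 <= k)%N -> measurable_fun setT (x^~ k)) ->
  measurable_fun setT (fun w => leftmost (x w) n).
Proof.
move=> mx; rewrite /leftmost /particles; under eq_fun do rewrite big_map.
apply: measurable_bigminr => [k|]; last exact: mx.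
by rewrite mem_iota => /andP[k1 _]; exact: mx.
Qed.

Lemma measurable_rightmost (x : T -> nat -> R) n :
  (forall k, (1 <= k)%N -> measurable_fun setT (x^~ k)) ->
  measurable_fun setT (fun w => rightmost (x w) n).
Proof.
move=> mx; rewrite /rightmost /particles; under eq_fun do rewrite big_map.
apply: measurable_bigmaxr => [k|]; last exact: mx.
by rewrite mem_iota => /andP[k1 _]; exact: mx.
Qed.

End measurability.

(** * Integrals over events independent of the past *)

Section independence_integral.
Context {d : measure_display} {T : measurableType d} {R : realType}.
Local Open Scope ereal_scope.

Lemma ge0_integral_mrestr (mu : {measure set T -> \bar R}) (D : set T)
    (mD : measurable D) (h : T -> \bar R) :
  measurable_fun setT h -> (forall w, 0 <= h w) ->
  \int[mrestr mu mD]_w h w = \int[mu]_(w in D) h w.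
Proof.
move=> mh h0.
rewrite [LHS](@ge0_negligible_integral _ _ _ _ _ (~` D)) //.
- rewrite setTD setCK; apply: eq_measure_integral => A mA AD.
  by rewrite /= /mrestr setIidl.
- exact: measurableC.
- by rewrite /= /mrestr setICl measure0.
Qed.

(** As set functions of E, P (E & F) and c * P E are measures that agree on the
pi-system G, hence on the sigma-algebra it generates; functions measurable for
that sigma-algebra have the same integral against both.  The two measures are
transported to [g_sigma_algebraType G], where they coincide everywhere. *)
Lemma integral_indep (P : probability T R) (G : set_system T) (F : set T)
    (c : {nonneg R}) (h : T -> \bar R) :
  G `<=` measurable -> setI_closed G -> G setT -> measurable F ->
  (forall E, G E -> P (E `&` F) = c%:num%:E * P E) ->
  measurable_fun setT (h : g_sigma_algebraType G -> \bar R) ->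
  (forall w, 0 <= h w) ->
  \int[P]_(w in F) h w = c%:num%:E * \int[P]_w h w.
Proof.
move=> Gm GI GT mF PF mh h0.
have sGm : <<s G >> `<=` (measurable : set_system T).
  by apply: smallest_sub => //; exact: sigma_algebra_measurable.
pose to_G : T -> g_sigma_algebraType G := id.
have m_to_G : measurable_fun setT to_G.
  by move=> _ A mA; rewrite setTI; exact: sGm.
have mhT : measurable_fun setT h by exact: (measurableT_comp mh m_to_G).
transitivity (\int[pushforward (mrestr P mF) to_G]_w h w).
  by rewrite ge0_integral_pushforward ?preimage_setT ?ge0_integral_mrestr.
transitivity (\int[pushforward (mscale c P) to_G]_w h w); last first.
  by rewrite ge0_integral_pushforward ?preimage_setT ?ge0_integral_mscale.
apply: eq_measure_integral => A mA _.
apply: (@measure_unique _ R (g_sigma_algebraType G) G (fun=> setT) erefl GI _ _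
  (pushforward (mrestr P mF) to_G) (pushforward (mscale c P) to_G)) => //.
- by rewrite bigcup_const//; exists 0%N.
- move=> k; apply: le_lt_trans (ltry 1).
  rewrite /= /pushforward /mrestr; apply: probability_le1.
  by rewrite preimage_setT setTI.
Qed.

End independence_integral.
Search (<<s _ >> `<=` _).

(** * Cylinder events and the past *)

Section cylinders.
Context {d : measure_display} {T : measurableType d} {R : realType}.
Context {d' : measure_display} {U : measurableType d'}.
Variables (P : probability T R) (X : nat -> {RV P >-> U}).
Implicit Types (J : {fset nat}) (D : set nat).

Definition cylinders J : set_system T :=
  [set E | exists A : nat -> set U, (forall i, measurable (A i)) /\
    E = \bigcap_(i in [set` J]) X i @^-1` A i].

Lemma cylinders_setT J : cylinders J setT.
Proof.
exists (fun=> setT); split=> [i|]; first exact: measurableT.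
by apply/seteqP; split.
Qed.

Lemma cylinders_setI J : setI_closed (cylinders J).
Proof.
move=> _ _ [A [mA ->]] [B [mB ->]]; exists (fun i => A i `&` B i).
split=> [i|]; first exact: measurableI.
by rewrite -bigcapI; apply: eq_bigcapr => i _; rewrite preimage_setI.
Qed.

Lemma cylinders_preimage J i (B : set U) : i \in J -> measurable B ->
  cylinders J (X i @^-1` B).
Proof.
move=> iJ mB; exists (fun k => if k == i then B else setT); split=> [k|].
  by case: ifP.
apply/seteqP; split=> [w Bw k _ /=|w /(_ i iJ)]; last by rewrite /= eqxx.
by case: eqP => [->|].
Qed.

Lemma measurable_preim_RV i (B : set U) :
  measurable B -> measurable (X i @^-1` B).
Proof. by move=> mB; rewrite -[_ @^-1` _]setTI; exact: measurable_funPT. Qed.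

Lemma sigma_seq_measurable D : sigma_seq D X `<=` measurable.
Proof.
apply: smallest_sub; first exact: sigma_algebra_measurable.
by move=> _ [i _ [B mB <-]]; rewrite setTI; exact: measurable_preim_RV.
Qed.

Lemma cylinders_sigma_seq J D :
  [set` J] `<=` D -> cylinders J `<=` sigma_seq D X.
Proof.
move=> JD _ [A [mA ->]].
apply: (@bigcap_measurableType _ (g_sigma_algebraType
  (\bigcup_(n in D) sigma_rv (X n)))) => i Ji.
by apply: sub_sigma_algebra; exists i; [exact: JD|exists (A i); rewrite ?setTI].
Qed.

(** Compare the product rule over J with the product rule over J and n: the new
factor is the probability of the event about X_n. *)
Lemma cylinders_indep J D n (E : set T) (B : set U) :
  independent P D (fun i => sigma_rv (X i)) ->
  [set` J] `<=` D -> D n -> n \notin J -> cylinders J E -> measurable B ->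
  P (X n @^-1` B `&` E) = (P (X n @^-1` B) * P E)%E.
Proof.
move=> indep JD Dn nJ [A [mA ->]] mB.
pose A' i := if i == n then B else A i.
have mA' i : sigma_rv (X i) (X i @^-1` A' i).
  by exists (A' i); rewrite ?setTI// /A'; case: ifP.
have A'J i : i \in J -> A' i = A i.
  by move=> iJ; rewrite /A' ifN//; apply: contraNneq nJ => <-.
have E_A' : \bigcap_(i in [set` J]) X i @^-1` A i =
    \bigcap_(i in [set` J]) X i @^-1` A' i.
  by apply: eq_bigcapr => i iJ; rewrite A'J.
have := indep (n |` J)%fset (fun i => X i @^-1` A' i).
rewrite big_fsetU1//= [A' n]/A' eqxx => indepnJ.
rewrite E_A' [in RHS](indep J (fun i => X i @^-1` A' i))//.
rewrite -indepnJ//; last first.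
  by move=> i /=; rewrite !inE => /orP[/eqP->//|]; exact: JD.
congr (P _); apply/seteqP; split=> w.
  move=> [Bw Aw] i /=; rewrite !inE => /orP[/eqP->|]; last exact: Aw.
  by rewrite /A' eqxx.
move=> A'w; split; last first.
  by move=> i iJ; apply: A'w; rewrite /= !inE [_ \in J]iJ orbT.
by have := A'w n; rewrite /= !inE eqxx /A' eqxx; exact.
Qed.

End cylinders.

Section independent_sequences.
Context {d : measure_display} {T : measurableType d} {R : realType}.
Context {d1 d2 d3} {T1 : measurableType d1} {T2 : measurableType d2}
  {T3 : measurableType d3}.
Variables (P : probability T R).
Variables (X1 : nat -> {RV P >-> T1}) (X2 : nat -> {RV P >-> T2})
  (X3 : nat -> {RV P >-> T3}) (D1 D2 D3 : set nat).
Hypothesis indep : independent_sequences3 D1 D2 D3 X1 X2 X3.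

Lemma independent_sequences3_prod E1 E2 E3 :
  sigma_seq D1 X1 E1 -> sigma_seq D2 X2 E2 -> sigma_seq D3 X3 E3 ->
  P (E1 `&` E2 `&` E3) = (P E1 * P E2 * P E3)%E.
Proof.
move=> s1 s2 s3.
pose E (i : 'I_3) := nth set0 [:: E1; E2; E3] i.
pose J : {fset 'I_3} := [fset i in enum 'I_3]%fset.
have inJ i : i \in J by rewrite !inE mem_enum.
have := indep (J := J) (E := E) (fun _ _ => Logic.I).
rewrite (perm_big (enum 'I_3)); last first.
  apply: uniq_perm; rewrite ?fset_uniq ?enum_uniq// => i.
  by rewrite inJ mem_enum.
rewrite big_enum/= !big_ord_recl big_ord0 mule1 muleA /E/= => <-.
  congr (P _); apply/seteqP; split=> [w [[w1 w2] w3] [[|[|[]]]]//|w wE].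
  by split; [split|]; [have := wE ord0|have := wE (lift ord0 ord0)|
    have := wE (lift ord0 (lift ord0 ord0))]; apply; exact: inJ.
by case=> [[|[|[|]]]].
Qed.

End independent_sequences.

Section history.
Context {d : measure_display} {T : measurableType d} {R : realType}.
Variables (P : probability T R).
Variables (chi : nat -> {RV P >-> nat}) (eps eta : nat -> {RV P >-> R}).

(** A pi-system that generates the sigma-algebra of chi_2, ..., chi_(n-1) and of
eps_i, eta_i for 3 <= i <= n, that is, of what has been used to build the first
n particles.  Intersections of one cylinder per sequence suffice, and on them
the independence hypotheses can be applied directly. *)
Definition history n : set_system T :=
  [set E | exists E1 E2 E3,
    [/\ cylinders chi [fset i in iota 2 (n - 2)]%fset E1,
        cylinders eps [fset i in iota 3 (n - 2)]%fset E2,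
        cylinders eta [fset i in iota 3 (n - 2)]%fset E3 &
        E = E1 `&` E2 `&` E3]].

Lemma history_setT n : history n setT.
Proof.
by exists setT, setT, setT; split; rewrite ?setTI//; exact: cylinders_setT.
Qed.

Lemma history_setI n : setI_closed (history n).
Proof.
move=> _ _ [A1 [A2 [A3 [cA1 cA2 cA3 ->]]]] [B1 [B2 [B3 [cB1 cB2 cB3 ->]]]].
exists (A1 `&` B1), (A2 `&` B2), (A3 `&` B3).
by split; [exact: cylinders_setI..|rewrite setIACA (setIACA A1)].
Qed.

Lemma history_measurable n : history n `<=` measurable.
Proof.
have cm (dU : measure_display) (U : measurableType dU)
    (X : nat -> {RV P >-> U}) J : cylinders X J `<=` measurable.
  move=> E cE; apply: (@sigma_seq_measurable _ _ _ _ _ P X setT).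
  exact: cylinders_sigma_seq cE.
move=> _ [E1 [E2 [E3 [c1 c2 c3 ->]]]].
apply: measurableI; last exact: cm c3.
by apply: measurableI; [exact: cm c1|exact: cm c2].
Qed.

Lemma history_chi n i : (2 <= i < n)%N ->
  measurable_fun setT (chi i : g_sigma_algebraType (history n) -> nat).
Proof.
move=> i_n _ B mB; rewrite setTI; apply: sub_sigma_algebra.
exists (chi i @^-1` B), setT, setT; rewrite !setIT; split=> //.
- by apply: cylinders_preimage => //; rewrite !inE mem_iota; lia.
- exact: cylinders_setT.
- exact: cylinders_setT.
Qed.

Lemma history_eps n i : (3 <= i <= n)%N ->
  measurable_fun setT (eps i : g_sigma_algebraType (history n) -> R).
Proof.
move=> i_n _ B mB; rewrite setTI; apply: sub_sigma_algebra.
exists setT, (eps i @^-1` B), setT; rewrite setIT setTI; split=> //.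
- exact: cylinders_setT.
- by apply: cylinders_preimage => //; rewrite !inE mem_iota; lia.
- exact: cylinders_setT.
Qed.

Lemma history_eta n i : (3 <= i <= n)%N ->
  measurable_fun setT (eta i : g_sigma_algebraType (history n) -> R).
Proof.
move=> i_n _ B mB; rewrite setTI; apply: sub_sigma_algebra.
exists setT, setT, (eta i @^-1` B); rewrite !setTI; split=> //.
- exact: cylinders_setT.
- exact: cylinders_setT.
- by apply: cylinders_preimage => //; rewrite !inE mem_iota; lia.
Qed.

Hypothesis chi_indep : independent P [set n | (2 <= n)%N]
  (fun n => sigma_rv (chi n)).
Hypothesis eta_indep : independent P [set n | (3 <= n)%N]
  (fun n => sigma_rv (eta n)).
Hypothesis seq_indep : independent_sequences3 [set n | (2 <= n)%N]
  [set n | (3 <= n)%N] [set n | (3 <= n)%N] chi eps eta.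

(** Split the event by sequence, use independence of the three sequences, and
within the chi and eta sequences separate the new variable from the past. *)
Lemma history_indep n (A : set nat) (B : set R) E : (2 <= n)%N ->
  measurable B -> history n E ->
  P (E `&` (chi n @^-1` A `&` eta n.+1 @^-1` B)) =
  (P (chi n @^-1` A) * P (eta n.+1 @^-1` B) * P E)%E.
Proof.
move=> n2 mB [E1 [E2 [E3 [c1 c2 c3 ->]]]].
have sub2 : [set` [fset i in iota 2 (n - 2)]%fset] `<=` [set n | (2 <= n)%N].
  by move=> i /=; rewrite !inE mem_iota => /andP[].
have sub3 : [set` [fset i in iota 3 (n - 2)]%fset] `<=` [set n | (3 <= n)%N].
  by move=> i /=; rewrite !inE mem_iota => /andP[].
have s1 := cylinders_sigma_seq sub2 c1.
have s2 := cylinders_sigma_seq sub3 c2.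
have s3 := cylinders_sigma_seq sub3 c3.
have sA : sigma_seq [set n | (2 <= n)%N] chi (chi n @^-1` A).
  by apply: sub_sigma_algebra; exists n => //; exists A; rewrite ?setTI.
have sB : sigma_seq [set n | (3 <= n)%N] eta (eta n.+1 @^-1` B).
  by apply: sub_sigma_algebra; exists n.+1 => //; exists B; rewrite ?setTI.
have -> : E1 `&` E2 `&` E3 `&` (chi n @^-1` A `&` eta n.+1 @^-1` B) =
    (chi n @^-1` A `&` E1) `&` E2 `&` (eta n.+1 @^-1` B `&` E3).
  by apply/seteqP; split => w /=; tauto.
rewrite [LHS](independent_sequences3_prod seq_indep) //; last 2 first.
- exact: (@measurableI _ (g_sigma_algebraType _)).
- exact: (@measurableI _ (g_sigma_algebraType _)).
rewrite (independent_sequences3_prod seq_indep) //.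
rewrite (cylinders_indep (D := [set n | (2 <= n)%N]) _ _ _ _ c1)//; last first.
  by rewrite !inE mem_iota; lia.
rewrite (cylinders_indep (D := [set n | (3 <= n)%N]) _ _ _ _ c3)//; last first.
  by rewrite !inE mem_iota; lia.
rewrite -!muleA; congr (_ * _)%E; rewrite [RHS]muleCA; congr (_ * _)%E.
exact: muleCA.
Qed.

End history.

(** * Almost sure ranges of the driving variables *)

Section almost_sure_ranges.
Context {d : measure_display} {T : measurableType d} {R : realType}.
Variable P : probability T R.
Local Open Scope ereal_scope.

Lemma ae_probability1 (A : set T) :
  measurable A -> P A = 1 -> {ae P, forall w, A w}.
Proof.
move=> mA PA; exists (~` A); split=> //; first exact: measurableC.
by rewrite [LHS]probability_setC// [P A]PA subee.
Qed.

Lemma probability1_ae (A : set T) :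
  measurable A -> {ae P, forall w, A w} -> P A = 1.
Proof.
move=> mA aeA; have mCA := measurableC mA.
have /(negligibleP P mCA) CA0 : P.-negligible (~` A) by [].
by rewrite -[A]setCK [LHS]probability_setC// [P (~` A)]CA0 sube0.
Qed.

Lemma ae_uniform_nat (X : {RV P >-> nat}) n : (0 < n)%N ->
  (forall k, (1 <= k <= n)%N -> P (X @^-1` [set k]) = (n%:R^-1)%:E) ->
  {ae P, forall w, (1 <= X w <= n)%N}.
Proof.
move=> n0 unifX.
have mX k : measurable (X @^-1` [set k]).
  by rewrite -[_ @^-1` _]setTI; exact: measurable_funPT.
have PA : P (\big[setU/set0]_(i < n) (X @^-1` [set i.+1])) = 1.
  rewrite measure_bigsetU_ord//; last first.
    by move=> i j _ _ [w [/= -> /= [/ord_inj]]].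
  rewrite (eq_bigr (fun=> (n%:R^-1)%:E)) => [|i _]; last first.
    by apply: unifX; case: i.
  rewrite sumEFin sumr_const card_ord -[(_^-1 *+ _)%R]mulr_natr mulVf//.
  by rewrite pnatr_eq0 -lt0n.
have /ae_probability1/(_ PA) :
    measurable (\big[setU/set0]_(i < n) (X @^-1` [set i.+1])).
  exact: bigsetU_measurable.
apply: filterS => w.
rewrite -(bigcup_mkord n (fun k => X @^-1` [set k.+1])) => -[i /= i_n ->].
by rewrite /= i_n.
Qed.

Lemma ae_sign (X : {RV P >-> R}) :
  P (X @^-1` [set 1%R]) = (2^-1)%:E -> P (X @^-1` [set (-1)%R]) = (2^-1)%:E ->
  {ae P, forall w, `|X w|%R = 1%R}.
Proof.
move=> P1 PN1.
have mX a : measurable (X @^-1` [set a]).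
  by rewrite -[_ @^-1` _]setTI; exact: measurable_funPT.
have PA : P (X @^-1` [set 1%R] `|` X @^-1` [set (-1)%R]) = 1.
  rewrite measureU//.
    apply: etrans (congr2 (fun a b => a + b) P1 PN1) _.
    by rewrite -EFinD; congr EFin; lra.
  by apply/seteqP; split=> // w [/= ->]; lra.
apply: filterS (ae_probability1 (measurableU _ _ (mX _) (mX _)) PA).
by move=> w [/= ->|/= ->]; rewrite ?normrN normr1.
Qed.

Lemma uniform_prob01_itv (c : R) : (0 <= c <= 1)%R ->
  uniform_prob (@ltr01 R) `[0%R, c]%classic = c%:E.
Proof.
move=> /andP[c0 c1]; rewrite /uniform_prob.
rewrite (eq_integral (cst 1%:E)) => [|r].
  rewrite integral_cst//= mul1e lebesgue_measure_itv/= lte_fin.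
  by have [_|c_le0] := ltP 0%R c; [rewrite -EFinB subr0|congr EFin; lra].
rewrite inE /= in_itv /= => /andP[r0 rc].
by rewrite /uniform_pdf r0 (le_trans rc c1) subr0 invr1.
Qed.

End almost_sure_ranges.

(** * The mean gap and the total displacement *)

Section lisa_process.
Context {d : measure_display} {T : measurableType d} {R : realType}.
Variable P : probability T R.
Variables (chi : nat -> {RV P >-> nat}) (eps eta : nat -> {RV P >-> R}).
Hypothesis chi_unif : forall n k : nat, (2 <= n)%N -> (1 <= k <= n)%N ->
  P (chi n @^-1` [set k]) = (n%:R^-1)%:E.
Hypothesis eps_pos : forall n : nat, (3 <= n)%N ->
  P (eps n @^-1` [set 1]) = (2^-1)%:E.
Hypothesis eps_neg : forall n : nat, (3 <= n)%N ->
  P (eps n @^-1` [set -1]) = (2^-1)%:E.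
Hypothesis eta_unif : forall n : nat, (3 <= n)%N -> forall A : set R,
  measurable A -> distribution P (eta n) A = uniform_prob (@ltr01 R) A.
Hypothesis chi_indep : independent P [set n | (2 <= n)%N]
  (fun n => sigma_rv (chi n)).
Hypothesis eta_indep : independent P [set n | (3 <= n)%N]
  (fun n => sigma_rv (eta n)).
Hypothesis seq_indep : independent_sequences3 [set n | (2 <= n)%N]
  [set n | (3 <= n)%N] [set n | (3 <= n)%N] chi eps eta.

(* With s = 1 the rightmost particle of [y] is that of [x]; with s = - 1 it is
   the leftmost one. *)
Variable s : R.
Hypothesis s1 : `|s| = 1.

Let x (w : T) : nat -> R :=
  lisa (fun n => chi n w) (fun n => eps n w) (fun n => eta n w).
Let y (w : T) (k : nat) : R := s * x w k.

(** The sign eps_n enters [lisa_step] through its modulus only, which is almost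
surely 1. *)
Lemma ae_lisa_step : {ae P, forall w, forall n, (2 <= n)%N ->
  lisa_step (y w) (fun n => chi n w) (fun n => eta n w) n}.
Proof.
have chi_ae n : {ae P, forall w, (2 <= n)%N -> (1 <= chi n w <= n)%N}.
  have [n2|n2] := leqP 2 n; last by apply: aeW => w; lia.
  by apply: filterS (ae_uniform_nat (ltnW n2) (fun k => chi_unif n2)).
have eps_ae n : {ae P, forall w, (2 <= n)%N -> `|eps n.+1 w| = 1}.
  have [n2|n2] := leqP 2 n; last by apply: aeW => w; lia.
  have n3 : (3 <= n.+1)%N by [].
  by apply: filterS (ae_sign (eps_pos n3) (eps_neg n3)).
have eta_ae n : {ae P, forall w, (2 <= n)%N -> 0 <= eta n.+1 w <= 1}.
  have [n2|n2] := leqP 2 n; last by apply: aeW => w; lia.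
  have mB : measurable (eta n.+1 @^-1` `[0, 1]%classic).
    exact: measurable_preim_RV.
  have PB : P (eta n.+1 @^-1` `[0, 1]%classic) = 1%E.
    by rewrite -(@uniform_prob01_itv R 1) ?ler01 ?lexx//; exact: eta_unif.
  by apply: filterS (ae_probability1 mB PB) => w /=; rewrite in_itv.
have := ae_foralln chi_ae; have := ae_foralln eps_ae; have := ae_foralln eta_ae.
apply: filterS3 => w eta01 eps1 chi1 n n2; split; [exact: chi1|exact: eta01|].
have /andP[eta0 _] := eta01 n n2.
rewrite /y nearest_distM// -mulrBr normrM s1 mul1r /x lisaS//; last exact: chi1.
rewrite addrAC subrr add0r !normrM eps1// mul1r !ger0_norm//.
exact: nearest_dist_ge0.
Qed.

Lemma measurable_y_history n k : (2 <= n)%N -> (1 <= k <= n)%N ->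
  measurable_fun setT
    ((fun w => y w k) : g_sigma_algebraType (history chi eps eta n) -> R).
Proof.
move=> n2 kn; apply: measurable_funM; first exact: measurable_cst.
apply: (measurable_lisa (T := g_sigma_algebraType (history chi eps eta n))
  (c := fun w i => chi i w) (e := fun w i => eps i w) (h := fun w i => eta i w)
  (n := n)) => // i.
- exact: history_chi.
- exact: history_eps.
- exact: history_eta.
Qed.

Lemma measurable_y k : (1 <= k)%N -> measurable_fun setT (fun w => y w k).
Proof.
move=> k1; apply: measurable_funM; first exact: measurable_cst.
apply: (measurable_lisa (c := fun w i => chi i w) (e := fun w i => eps i w)
  (h := fun w i => eta i w) (n := k)) => //.
by rewrite k1 leqnn.
Qed.

Lemma measurable_gap_y n : (1 <= n)%N ->
  measurable_fun setT (fun w => gap (y w) n).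
Proof.
by move=> n1; apply: measurable_gap => // j /andP[j1 _]; exact: measurable_y.
Qed.

Local Open Scope ereal_scope.

Definition mean_gap n := \int[P]_w (gap (y w) n)%:E.

Lemma gap_y_ge0 n w : (2 <= n)%N -> 0 <= (gap (y w) n)%:E.
Proof. by move=> n2; rewrite lee_fin gap_ge0. Qed.

Lemma mean_gap_ge0 n : (2 <= n)%N -> 0 <= mean_gap n.
Proof. by move=> n2; apply: integral_ge0 => w _; exact: gap_y_ge0. Qed.

(** [B] is [0, 1/2] when the loss of gap is estimated, and everything when the
displacement is. *)
Let hit n (B : set R) w := (chi n w == argmax (y w) n) && (eta n.+1 w \in B).

Lemma measurable_hit_gap n (B : set R) : (2 <= n)%N -> measurable B ->
  measurable_fun setT (fun w => (gap (y w) n * (hit n B w)%:R)%:E).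
Proof.
move=> n2 mB; have n1 := ltnW n2.
apply/measurable_EFinP; apply: measurable_funM; first exact: measurable_gap_y.
apply: measurable_natr_bool; apply: measurable_and.
  apply: measurable_fun_eqn => //.
  by apply: measurable_argmax => // j /andP[j1 _]; exact: measurable_y.
apply: (measurable_fun_bool true); rewrite setTI.
rewrite (_ : _ @^-1` _ = eta n.+1 @^-1` B); first exact: measurable_preim_RV.
by apply/seteqP; split=> w /=; [exact: set_mem|exact: mem_set].
Qed.

(** The index of the rightmost particle is random, so the independence of chi_n
from the past cannot be applied to it directly.  The event is split over the n
possible indices k; the gap restricted to the event that the index is k depends
on the past only, and the event that the parent is k is independent of it. *)
Lemma mean_hit_gap n (B : set R) (b : R) : (2 <= n)%N -> measurable B ->
  (0 <= b)%R -> P (eta n.+1 @^-1` B) = b%:E ->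
  \int[P]_w (gap (y w) n * (hit n B w)%:R)%:E = (b / n%:R)%:E * mean_gap n.
Proof.
move=> n2 mB b0 PB.
pose F k := chi n @^-1` [set k] `&` eta n.+1 @^-1` B.
pose h k w := (gap (y w) n * (argmax (y w) n == k)%:R)%:E.
have n1 : (1 <= n)%N by exact: ltnW.
have mF k : measurable (F k).
  apply: measurableI; first exact: measurable_preim_RV.
  exact: measurable_preim_RV.
have h0 k w : 0 <= h k w by rewrite lee_fin mulr_ge0 ?gap_ge0.
have mh k : measurable_fun setT
    (h k : g_sigma_algebraType (history chi eps eta n) -> \bar R).
  apply/measurable_EFinP; apply: measurable_funM.
    by apply: measurable_gap => // j; exact: measurable_y_history.
  apply: measurable_natr_bool.
  apply: measurable_fun_eqn; last exact: measurable_cst.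
  by apply: measurable_argmax => // j; exact: measurable_y_history.
have mhT k : measurable_fun setT (h k).
  apply/measurable_EFinP; apply: measurable_funM; first exact: measurable_gap_y.
  apply: measurable_natr_bool.
  apply: measurable_fun_eqn; last exact: measurable_cst.
  by apply: measurable_argmax => // j /andP[j1 _]; exact: measurable_y.
have bn0 : (0 <= b / n%:R)%R by rewrite divr_ge0.
have int_h k : (1 <= k <= n)%N ->
    \int[P]_(w in F k) h k w = (b / n%:R)%:E * \int[P]_w h k w.
  move=> kn; apply: (integral_indep (G := history chi eps eta n)
    (c := NngNum bn0)) => //.
  - exact: history_measurable.
  - exact: history_setI.
  - exact: history_setT.
  - move=> E hE; rewrite (history_indep chi_indep eta_indep seq_indep)//.
    by rewrite [P (chi n @^-1` _)]chi_unif// [P (eta _ @^-1` _)]PB -EFinM mulrC.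
transitivity (\int[P]_w \sum_(k < n) (h k.+1 \_ (F k.+1)) w).
  apply: eq_integral => w _.
  have /andP[r1 rn] := argmax_bounds (y w) n1.
  have rn' : ((argmax (y w) n).-1 < n)%N by rewrite prednK.
  rewrite (bigD1 (Ordinal rn')) //= prednK// big1 ?adde0.
    rewrite patchE /h eqxx mulr1 /hit.
    rewrite (_ : (w \in F _) =
        (chi n w == argmax (y w) n) && (eta n.+1 w \in B)).
      by case: ifP => _; rewrite ?mulr1 ?mulr0.
    by apply/idP/andP; rewrite !inE => -[/eqP].
  move=> k; rewrite patchE /h; case: ifP => // _ /eqP kr.
  case: eqP => [rk|]; last by rewrite mulr0.
  by case: kr; apply/val_inj; rewrite /= rk.
rewrite ge0_integral_sum//; last 2 first.
- move=> k; apply/(measurable_restrictT _ _).1 => //.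
  exact: measurable_funTS.
- by move=> k w _; apply: erestrict_ge0.
under eq_bigr do rewrite -integral_mkcond int_h ?ltn_ord//.
rewrite -ge0_sume_distrr; last by move=> k _; apply: integral_ge0.
congr (_ * _); rewrite -ge0_integral_sum//.
apply: eq_integral => w _.
have /andP[r1 rn] := argmax_bounds (y w) n1.
have rn' : ((argmax (y w) n).-1 < n)%N by rewrite prednK.
rewrite (bigD1 (Ordinal rn')) //= /h prednK// eqxx mulr1.
rewrite big1 ?adde0// => k /eqP kr.
case: eqP => [rk|]; last by rewrite mulr0.
by case: kr; apply/val_inj; rewrite /= rk.
Qed.

(** 1/4 = 1/2 * 1/2: the gap loses half of its value with probability 1/2 when
the rightmost particle is hit. *)
Lemma mean_gap_step n : (2 <= n)%N ->
  (4^-1 / n%:R)%:E * mean_gap n + mean_gap n.+1 <= mean_gap n.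
Proof.
move=> n2; pose B : set R := `[0%R, 2^-1%R]%classic.
have n3 : (3 <= n.+1)%N by [].
have mB : measurable B by exact: measurable_itv.
have PB : P (eta n.+1 @^-1` B) = (2^-1)%:E.
  rewrite -(@uniform_prob01_itv R 2^-1); [exact: eta_unif|lra].
rewrite (_ : 4^-1 / n%:R = 2^-1 * (2^-1 / n%:R))%R; last first.
  by rewrite mulrA; congr (_ / _)%R; lra.
rewrite EFinM -muleA -(mean_hit_gap n2 mB _ PB); last by lra.
have mhit := measurable_hit_gap n2 mB.
have hit0 w : 0 <= (gap (y w) n * (hit n B w)%:R)%:E.
  by rewrite lee_fin mulr_ge0 ?gap_ge0.
have mgap m : (1 <= m)%N -> measurable_fun setT (fun w => (gap (y w) m)%:E).
  by move=> m1; apply/measurable_EFinP; exact: measurable_gap_y.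
have half0 : 0 <= (2^-1 : R)%:E by rewrite lee_fin; lra.
rewrite -[X in X + _](ge0_integralZl _ measurableT mhit)//.
rewrite -[leLHS]ge0_integralD => //; last 4 first.
- by move=> w _; rewrite mule_ge0.
- exact: measurable_funeM.
- by move=> w _; rewrite gap_y_ge0// leqW.
- exact: mgap.
apply: ae_ge0_le_integral => //.
- by move=> w _; rewrite adde_ge0 ?mule_ge0 ?gap_y_ge0// leqW.
- by apply: emeasurable_funD; [exact: measurable_funeM|exact: mgap].
- by move=> w _; exact: gap_y_ge0.
- by apply: mgap; exact: ltnW.
apply: filterS ae_lisa_step => w /(_ n n2)/(gap_step n2) + _.
rewrite -EFinM -EFinD lee_fin addrC /hit.
by rewrite (_ : (_ \in B) = (0 <= eta n.+1 w <= 2^-1)%R) ?mem_setE ?in_itv.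
Qed.

Lemma mean_gap2_le1 : mean_gap 2 <= 1.
Proof.
rewrite -[leRHS](probability_setT P) -[leRHS]mul1e -integral_cst//.
apply: ge0_le_integral => //.
- by move=> w _; exact: gap_y_ge0.
- by apply/measurable_EFinP; exact: measurable_gap_y.
move=> w _; rewrite lee_fin /gap; have := @argmax_bounds R (y w) 2 isT.
case: (argmax _ _) => [|[|[|]]]// _.
  apply: le_trans (nearest_dist_le (j := 2) _ _ _ _) _ => //.
  by rewrite /y /x lisa1 lisa2 mulr0 mulr1 sub0r normrN s1.
apply: le_trans (nearest_dist_le (j := 1) _ _ _ _) _ => //.
by rewrite /y /x lisa1 lisa2 mulr0 mulr1 subr0 s1.
Qed.

Lemma sum_mean_gap_le N :
  \sum_(i < N) (4^-1 / i.+2%:R)%:E * mean_gap i.+2 + mean_gap N.+2 <= 1.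
Proof.
elim: N => [|N IH]; first by rewrite big_ord0 add0e mean_gap2_le1.
rewrite big_ord_recr/= -addeA; apply: le_trans IH.
by apply: leeD2l; exact: mean_gap_step.
Qed.

(** By [max_step] this bounds the displacement of the maximum over all times. *)
Let total w := \sum_(i <oo) (gap (y w) i.+2 * (hit i.+2 setT w)%:R)%:E.

(** The terms of the series have mean e_n / n, which is 4 times the telescoping
decrement in [sum_mean_gap_le]. *)
Lemma mean_total_lty : \int[P]_w total w < +oo.
Proof.
rewrite integral_nneseries//; last 2 first.
- by move=> n; exact: measurable_hit_gap.
- by move=> n w _; rewrite lee_fin mulr_ge0 ?gap_ge0.
apply: (@le_lt_trans _ _ 4%:E); last exact: ltry.
apply: lime_le.
  apply: is_cvg_nneseries => n _ _; apply: integral_ge0 => w _.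
  by rewrite lee_fin mulr_ge0 ?gap_ge0.
apply: nearW => N; rewrite big_mkord.
under eq_bigr.
  move=> i _; rewrite (@mean_hit_gap _ _ 1)//; last first.
    by rewrite preimage_setT probability_setT.
  rewrite (_ : 1 / _ = 4 * (4^-1 / i.+2%:R))%R; last first.
    by rewrite mulrA divff ?pnatr_eq0.
  rewrite EFinM -muleA; over.
rewrite -ge0_sume_distrr; last first.
  by move=> i _; rewrite mule_ge0 ?mean_gap_ge0// lee_fin divr_ge0.
rewrite -[leRHS]mule1; apply: lee_wpmul2l; first by rewrite lee_fin.
apply: le_trans (sum_mean_gap_le N); apply: leeDl; exact: mean_gap_ge0.
Qed.

Lemma ae_bounded_above : {ae P, forall w, exists C : R,
  forall k, (1 <= k)%N -> (y w k <= C)%R}.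
Proof.
have mtotal : measurable_fun setT total.
  apply: ge0_emeasurable_sum => [i w _ _|i _].
    by rewrite lee_fin mulr_ge0 ?gap_ge0.
  exact: measurable_hit_gap.
have total_ge0 w : 0 <= total w.
  by apply: nneseries_ge0 => i _ _; rewrite lee_fin mulr_ge0 ?gap_ge0.
have itotal : P.-integrable setT total.
  apply/integrableP; split=> //.
  by under eq_integral do rewrite gee0_abs//; exact: mean_total_lty.
have := integrable_ae measurableT itotal.
apply: filterS2 ae_lisa_step => w step /(_ Logic.I) total_fin.
exists (y w (argmax (y w) 2) + fine (total w))%R => k k1.
have [k2 kk2] : exists n, (k <= n.+2)%N by exists k; rewrite !leqW.
apply: le_trans (le_argmax (y w) (n := k2.+2) _) _; first by rewrite k1.
apply: le_trans (max_le_sum step k2) _; rewrite lerD2l -lee_fin fineK//.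
rewrite -sumEFin; apply: le_trans (nneseries_lim_ge k2 _); last first.
  by move=> n _ _; rewrite lee_fin mulr_ge0 ?gap_ge0.
rewrite big_mkord; apply: lee_sum => i _.
by rewrite /hit in_setT andbT.
Qed.

End lisa_process.

(** * Boundedness *)

Section limit_bounds.
Context {R : realType}.
Implicit Types (u v : (\bar R)^nat) (c : \bar R).
Local Open Scope ereal_scope.

Lemma limn_einf_ge u c : (forall n, c <= u n) -> c <= limn_einf u.
Proof.
move=> cu; rewrite limn_einf_lim; apply: lime_ge; first exact: is_cvg_einfs.
by apply: nearW => n; apply: le_ereal_inf_tmp => _ [k _ <-].
Qed.

Lemma le_limn_esup u v : (forall n, u n <= v n) -> limn_esup u <= limn_esup v.
Proof.
move=> uv; rewrite !limn_esup_lim; apply: lee_lim; [exact: is_cvg_esups..|].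
apply: nearW => n; apply: ge_ereal_sup => _ [k nk <-].
by apply: le_trans (uv k) _; apply: ereal_sup_ubound; exists k.
Qed.

Lemma limn_esup_le u c : (forall n, u n <= c) -> limn_esup u <= c.
Proof.
move=> uc; rewrite -[c]oppeK -[leLHS]oppeK -limn_einfN leeN2.
by apply: limn_einf_ge => n; rewrite /= leeN2.
Qed.

End limit_bounds.

Unset Implicit Arguments.

(** The two reflections of [ae_bounded_above] bound all positions from above and
from below, uniformly in time.  The event is shown measurable because [P] is not
assumed complete. *)
Theorem theorem1 (d : measure_display) (T : measurableType d) (R : realType)
    (P : probability T R)
    (chi : nat -> {RV P >-> nat}) (eps eta : nat -> {RV P >-> R})
    (chi_unif : forall n k : nat, (2 <= n)%N -> (1 <= k <= n)%N ->
      P (chi n @^-1` [set k]) = (n%:R^-1)%:E)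
    (eps_pos : forall n : nat, (3 <= n)%N ->
      P (eps n @^-1` [set 1]) = (2^-1)%:E)
    (eps_neg : forall n : nat, (3 <= n)%N ->
      P (eps n @^-1` [set -1]) = (2^-1)%:E)
    (eta_unif : forall n : nat, (3 <= n)%N -> forall A : set R, measurable A ->
      distribution P (eta n) A = uniform_prob (@ltr01 R) A)
    (chi_indep : independent P [set n | (2 <= n)%N]
      (fun n => sigma_rv (chi n)))
    (eps_indep : independent P [set n | (3 <= n)%N]
      (fun n => sigma_rv (eps n)))
    (eta_indep : independent P [set n | (3 <= n)%N]
      (fun n => sigma_rv (eta n)))
    (seq_indep : independent_sequences3 [set n | (2 <= n)%N]
      [set n | (3 <= n)%N] [set n | (3 <= n)%N] chi eps eta) :
  let x (w : T) : nat -> R :=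
    lisa (fun n => chi n w) (fun n => eps n w) (fun n => eta n w) in
  (P [set w | -oo < limn_einf (fun n => (leftmost (x w) n)%:E) /\
              limn_einf (fun n => (leftmost (x w) n)%:E)
                <= limn_esup (fun n => (rightmost (x w) n)%:E) /\
              limn_esup (fun n => (rightmost (x w) n)%:E) < +oo] = 1)%E.
Proof.
move=> x.
have mx k : (1 <= k)%N -> measurable_fun setT (fun w => x w k).
  move=> k1; have := measurable_y chi eps eta 1 k1.
  by under eq_fun do rewrite mul1r.
pose lo w := limn_einf (fun n => (leftmost (x w) n)%:E).
pose hi w := limn_esup (fun n => (rightmost (x w) n)%:E).
have mhi : measurable_fun setT hi.
  apply: measurable_fun_limn_esup => n; apply/measurable_EFinP.
  exact: measurable_rightmost.
have mlo : measurable_fun setT lo.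
  apply: measurableT_comp => //.
  apply: (measurable_fun_limn_esup
    (f := fun n w => (- (leftmost (x w) n)%:E)%E)) => n.
  apply: measurableT_comp => //; apply/measurable_EFinP.
  exact: measurable_leftmost.
(* The middle inequality always holds, so the event is an intersection of two
   measurable ones. *)
have lohi w : (lo w <= hi w)%E.
  apply: le_trans (limn_einf_sup _) _; apply: le_limn_esup => n.
  by rewrite lee_fin leftmost_le_rightmost.
rewrite (_ : [set w | _] =
    [set w | -oo < lo w]%E `&` [set w | hi w < +oo]%E); last first.
  apply/seteqP; split=> w; first by case=> ? [].
  by case=> ? ?; split=> //; split=> //; exact: lohi.
apply: probability1_ae.
  apply: measurableI; rewrite -[X in measurable X]setTI.
    exact: emeasurable_fun_o_infty.
  exact: emeasurable_fun_infty_o.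
have bounded s : `|s| = 1 -> {ae P, forall w, exists C : R,
    forall k, (1 <= k)%N -> s * x w k <= C}.
  exact: (ae_bounded_above chi_unif eps_pos eps_neg eta_unif chi_indep eta_indep
    seq_indep).
have := bounded (-1) _; have := bounded 1 _.
rewrite normrN normr1 => /(_ erefl) ub /(_ erefl) lb.
apply: filterS2 ub lb => w [C xC] [D xD]; split.
  apply: (@lt_le_trans _ _ (- D)%:E); first exact: ltNyr.
  apply: limn_einf_ge => n; rewrite lee_fin; apply: leftmost_ge => k k1.
  by rewrite lerNl -mulN1r xD.
apply: (@le_lt_trans _ _ C%:E); last exact: ltry.
apply: limn_esup_le => n; rewrite lee_fin; apply: rightmost_le => k k1.
by rewrite -[leLHS]mul1r xC.
Qed.
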